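(* Let $a,c,q>0$ be real. Then $$\int_0^\infty \frac{x}{x^2+c^2}\,e^{-a^2x^2}J_0(qx)\,dx = e^{(ac)^2}K_0(qc)-\frac{2a^2}{q^2}\,e^{-q^2/4a^2}\sum_{p=0}^\infty\left(\frac{2a^2c}{q}\right)^{2p}{}_2F_0\!\left(p+1,p+1;-\frac{4a^2}{q^2}\right),$$ and, equivalently, $$\int_0^\infty \frac{x}{x^2+c^2}\,e^{-a^2x^2}J_0(qx)\,dx = e^{(ac)^2}K_0(qc)-\frac12\,e^{-q^2/4a^2}\sum_{p=0}^\infty (ac)^{2p}\,\Psi\!\left(p+1,1;\frac{q^2}{4a^2}\right).$$
   Context: $J_0$ is the Bessel function of the first kind of order zero and $K_0$ is the modified Bessel function of the second kind (Macdonald function) of order zero. $\Psi(\alpha,\gamma;x)$ is the confluent hypergeometric function of the second kind (Tricomi function, also written $U(\alpha,\gamma,x)$); for $\alpha>0$, $x>0$ it is $\Psi(\alpha,\gamma;x)=\frac{1}{\Gamma(\alpha)}\int_0^\infty e^{-xt}t^{\alpha-1}(1+t)^{\gamma-\alpha-1}\,dt$. The symbol ${}_2F_0$ (whose defining power series diverges) is understood through the Whittaker function of the second kind $W_{\chi,\mu}$ by the relation $W_{\chi,\mu}(x)=e^{-x/2}x^{\chi}\,{}_2F_0\!\left(\tfrac12-\chi+\mu,\tfrac12-\chi-\mu;-\tfrac1x\right)$ for $x>0$, where $W_{\chi,\mu}(x)=e^{-x/2}x^{\mu+1/2}\,\Psi\!\left(\tfrac12-\chi+\mu,2\mu+1;x\right)$;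 in particular ${}_2F_0(p+1,p+1;-1/x)=x^{p+1}\,\Psi(p+1,1;x)$ for $x>0$ and integers $p\ge 0$. *)

(* Defs.v *)
From HB Require Import structures.
From mathcomp Require Import all_boot all_order all_algebra.
From mathcomp Require Import all_classical all_reals all_analysis.
From mathcomp Require Import ring.

Set Implicit Arguments.
Unset Strict Implicit.
Unset Printing Implicit Defensive.
Import Order.TTheory GRing.Theory Num.Theory.
Import numFieldNormedType.Exports.
Local Open Scope classical_set_scope.
Local Open Scope ring_scope.

Definition besselJ0 (R : realType) (x : R) : R :=
  limn (series (fun k : nat => (-1) ^+ k * (x / 2) ^+ (2 * k) / (k`!%:R) ^+ 2)).

(* The integral of exp (- x cosh t) over t > 0; meaningful for 0 < x. *)
Definition besselK0 (R : realType) (x : R) : R :=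
  \int[lebesgue_measure]_(t in `]0%R, +oo[)
    expR (- (x * ((expR t + expR (- t)) / 2))).

(* Euler's Gamma function; meaningful for 0 < s. *)
Definition eulerGamma (R : realType) (s : R) : R :=
  \int[lebesgue_measure]_(t in `]0%R, +oo[) (t `^ (s - 1) * expR (- t)).

(* Meaningful for 0 < alpha and 0 < x. *)
Definition tricomi (R : realType) (alpha gamma x : R) : R :=
  (eulerGamma alpha)^-1 *
  \int[lebesgue_measure]_(t in `]0%R, +oo[)
    (expR (- (x * t)) * t `^ (alpha - 1) * (1 + t) `^ (gamma - alpha - 1)).

Definition whittakerW (R : realType) (chi mu x : R) : R :=
  expR (- (x / 2)) * x `^ (mu + 2^-1) *
  tricomi (2^-1 - chi + mu) (2 * mu + 1) x.

(* For z < 0, the value of 2F0(a, b; z) is the one that makes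
   W_{chi,mu}(x) = e^{-x/2} x^chi 2F0(1/2 - chi + mu, 1/2 - chi - mu; -1/x)
   hold: solve -1/x = z, 1/2 - chi + mu = a and 1/2 - chi - mu = b for x, chi
   and mu. See whittakerW_hyp2F0 and hyp2F0_tricomi below. *)
Definition hyp2F0 (R : realType) (a b z : R) : R :=
  let x := - z^-1 in
  let chi := (1 - a - b) / 2 in
  let mu := (a - b) / 2 in
  expR (x / 2) * x `^ (- chi) * whittakerW chi mu x.

Lemma whittakerW_hyp2F0 (R : realType) (chi mu x : R) : 0 < x ->
  whittakerW chi mu x =
  expR (- (x / 2)) * x `^ chi *
  hyp2F0 (2^-1 - chi + mu) (2^-1 - chi - mu) (- x^-1).
Proof.
move=> x0; rewrite /hyp2F0 /= invrN invrK opprK.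
have -> : (1 - (2^-1 - chi + mu) - (2^-1 - chi - mu)) / 2 = chi by field.
have -> : (2^-1 - chi + mu - (2^-1 - chi - mu)) / 2 = mu by field.
rewrite expRN powRN.
have ? : expR (x / 2) != 0 by rewrite gt_eqF// expR_gt0.
have ? : x `^ chi != 0 by rewrite gt_eqF// powR_gt0.
by field; apply/andP.
Qed.

Lemma hyp2F0_tricomi (R : realType) (p : nat) (x : R) : 0 < x ->
  hyp2F0 p.+1%:R p.+1%:R (- x^-1) = x ^+ p.+1 * tricomi p.+1%:R 1 x.
Proof.
move=> x0; rewrite /hyp2F0 /whittakerW /= invrN invrK opprK.
rewrite subrr mul0r add0r addr0 mulr0 add0r.
have -> : 2^-1 - (1 - p.+1%:R - p.+1%:R) / 2 = p.+1%:R :> R by field.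
rewrite expRN.
have ? : expR (x / 2) != 0 by rewrite gt_eqF// expR_gt0.
rewrite -powR_mulrn ?ltW//.
have -> : p.+1%:R = - ((1 - p.+1%:R - p.+1%:R) / 2) + 2^-1 :> R by field.
rewrite [in RHS]powRD; last by rewrite gt_eqF ?implybT.
have -> : - ((1 - p.+1%:R - p.+1%:R) / 2) + 2^-1 = p.+1%:R :> R by field.
by field.
Qed.

(* Main.v *)
Require Import Defs.
From HB Require Import structures.
From mathcomp Require Import all_boot all_order all_algebra.
From mathcomp Require Import all_classical all_reals all_analysis.
From mathcomp Require Import measurable_realfun ring.
Import Order.TTheory GRing.Theory Num.Theory.
Import numFieldNormedType.Exports.
Local Open Scope classical_set_scope.
Local Open Scope ring_scope.

Set Implicit Arguments.
Unset Strict Implicit.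
Unset Printing Implicit Defensive.

(* Expand J_0 in its power series and replace 1/(x^2+c^2) by the integral of
   exp(-s(x^2+c^2)) over s > 0: the Gaussian moments resum to an exponential, and
   the left-hand side becomes the integral over s > 0 of
     exp(-s c^2 - q^2/(4(a^2+s))) / (2(a^2+s)).
   With h(t) = exp(-q c cosh t) and r = 2 a^2 c/q, the substitution
   e^t = (2c/q)(s+a^2) turns it into e^{(ac)^2}/2 times the integral of h over
   [ln r, +oo[.  Summed under the integral sign, the Tricomi series becomes, by
   e^t = (1+s)/r, a multiple of the integral of h over [-ln r, +oo[.
   As h is even, the two tails add up to 2 K_0(qc). *)

(** * Termwise integration of a series of functions *)

(** Dominated convergence for the partial sums. Bounding the partial sums of norms by [G] makes [G]
    dominate each term and each partial sum at once. Integrability of [F] is part of the conclusion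
    because later steps need its integral to be a genuine finite value. *)
Lemma Rintegral_series d (T : measurableType d) (R : realType)
    (mu : {measure set T -> \bar R}) (D : set T) (f : nat -> T -> R)
    (F G : T -> R) :
  measurable D -> (forall k, measurable_fun D (f k)) ->
  mu.-integrable D (EFin \o G) ->
  (forall x n, D x -> \sum_(0 <= k < n) `|f k x| <= G x) ->
  (forall x, D x -> series (f ^~ x) @ \oo --> F x) ->
  mu.-integrable D (EFin \o F) /\
  series (fun k => \int[mu]_(x in D) f k x) @ \oo --> \int[mu]_(x in D) F x.
Proof.
move=> mD mf iG fG fF.
have mS n : measurable_fun D (fun x => series (f ^~ x) n).
  exact: measurable_sum.
have mF : measurable_fun D F by exact: measurable_fun_cvg fF.
have if_ k : mu.-integrable D (EFin \o f k).
  apply: (le_integrable mD _ _ iG); first exact/measurable_EFinP.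
  move=> x Dx /=; rewrite lee_fin (le_trans _ (ler_norm _))//.
  by rewrite (le_trans _ (fG x k.+1 Dx))// big_nat_recr//= lerDr sumr_ge0.
have [] := @dominated_convergence _ _ _ mu D mD
  (fun n x => (series (f ^~ x) n)%:E) (EFin \o F) (EFin \o G) _ _ _ iG.
- by move=> n; exact/measurable_EFinP.
- exact/measurable_EFinP.
- by apply: aeW => x Dx; apply: cvg_EFin; [exact: nearW|exact: fF].
- apply: aeW => x n Dx; rewrite lee_fin seriesEnat/=.
  exact: le_trans (ler_norm_sum _ _ _) (fG x n Dx).
move=> iF _ cvF.
split => //; rewrite -(fineK (integrable_fin_num mD iF)) in cvF.
move/fine_cvg : cvF; apply: cvg_trans; apply: near_eq_cvg.
apply: nearW => n /=; rewrite seriesEnat/=.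
(* The interchange with a finite sum goes by induction, each partial sum being integrable by
   domination. *)
elim: n => [|n ih].
  rewrite big_geq// [X in fine X](_ : _ = 0%E)//.
  by apply: integral0_eq => x _; rewrite seriesEnat/= big_geq.
rewrite big_nat_recr//= -ih -RintegralD//.
  by congr fine; apply: eq_integral => x _; rewrite seriesSr.
apply: (le_integrable mD _ _ iG); first exact/measurable_EFinP.
move=> x Dx; rewrite lee_fin (le_trans _ (ler_norm _))//.
exact: le_trans (ler_norm_sum _ _ _) (fG x n Dx).
Qed.

(** * Truncated exponential series and the elementary integrals they evaluate *)

Lemma series_exp_coeff_le (R : realType) (x : R) (n : nat) : 0 <= x ->
  \sum_(0 <= k < n) x ^+ k / k`!%:R <= expR x.
Proof.
move=> x0; apply: (@nondecreasing_cvgn_le _ (series (exp_coeff x))) => //.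
  by apply: nondecreasing_series => k _ _; exact: exp_coeff_ge0.
exact: is_cvg_series_exp_coeff.
Qed.

(* [-expNsum k] is an antiderivative of [y^k e^-y / k!] that vanishes at infinity. *)
Definition expNsum (R : realType) (k : nat) (y : R) : R :=
  expR (- y) * \sum_(j < k.+1) y ^+ j / j`!%:R.

Lemma expNsum0 (R : realType) (k : nat) : expNsum k 0 = 1 :> R.
Proof.
rewrite /expNsum oppr0 expR0 mul1r big_ord_recl/= expr0 fact0 divr1 big1 ?addr0//.
by move=> i _; rewrite expr0n mul0r.
Qed.

(** Telescoping: the new summand e^-y y^(k+1)/(k+1)! has derivative e^-y y^k/k! - e^-y
    y^(k+1)/(k+1)!, whose first part cancels the induction hypothesis. *)
Lemma is_derive_expNsum (R : realType) (k : nat) (y : R) :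
  is_derive y 1 (@expNsum R k) (- (expR (- y) * (y ^+ k / k`!%:R))).
Proof.
elim: k => [|k ih].
  rewrite (_ : @expNsum R 0 = expR \o -%R); last first.
    by apply/funext => z; rewrite /expNsum big_ord1 expr0 fact0 divr1 mulr1.
  rewrite expr0 fact0 divr1 mulr1.
  have := @is_derive1_comp _ expR -%R y _ _ (is_derive_expR _) (is_deriveNid _ _).
  by rewrite mulrN1.
rewrite (_ : @expNsum R k.+1 =
  (fun z => @expNsum R k z + expR (- z) * (z ^+ k.+1 / k.+1`!%:R))); last first.
  by apply/funext => z; rewrite /expNsum big_ord_recr/= mulrDr.
have eD : is_derive y 1 (fun z : R => expR (- z)) (- expR (- y)).
  have := @is_derive1_comp _ expR -%R y _ _ (is_derive_expR _) (is_deriveNid _ _).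
  by rewrite mulrN1.
have ? : k`!%:R != 0 :> R by rewrite pnatr_eq0 -lt0n fact_gt0.
have ? : 1 + k%:R != 0 :> R by rewrite nat1r.
have pD : is_derive y 1 (fun z : R => z ^+ k.+1 / k.+1`!%:R) (y ^+ k / k`!%:R).
  have idX := @is_deriveX _ _ id k.+1 y 1 1 (is_derive_id _ _).
  have := @is_deriveZ _ _ _ _ (k.+1`!%:R^-1) _ _ _ idX.
  rewrite (_ : _ \*: _ = (fun z : R => z ^+ k.+1 / k.+1`!%:R)); last first.
    by apply/funext => z; rewrite /GRing.scale/= mulrC exprfctE.
  move=> h; apply: is_derive_eq h _.
  rewrite /GRing.scale/= factS natrM -natr1 addrC.
  by field; apply/andP.
apply: is_derive_eq (is_deriveD ih (is_deriveM eD pD)) _.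
rewrite /GRing.scale/= factS natrM -natr1 addrC exprS.
field; apply/andP; split => //.
Qed.

Lemma expNsum_cvg (R : realType) (k : nat) :
  @expNsum R k y @[y --> +oo%R] --> (0 : R).
Proof.
have h j : (expR (- y) * (y ^+ j / j`!%:R)) @[y --> +oo%R] --> (0 : R).
  (* The bound (j+1)/y comes from keeping only the term y^(j+1)/(j+1)! of e^y. *)
  apply: (@squeeze_cvgr _ _ _ _ (cst 0) (fun y => j.+1%:R * y^-1)); last 2 first.
  - exact: cvg_cst.
  - rewrite -(mulr0 (j.+1%:R)); apply: cvgMr.
    by apply/gtr0_cvgV0; [exact: nbhs_pinfty_gt|exact: cvg_id].
  near=> y; have y0 : 0 < y by [].
  apply/andP; split.
    by rewrite mulr_ge0 ?expR_ge0 ?divr_ge0 ?exprn_ge0 ?ltW.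
  rewrite expRN ler_pdivrMl ?expR_gt0// mulrA ler_pdivlMr//.
  have := expR_ge1Dxn j (ltW y0); rewrite factS natrM exprSr => h.
  have {h} : y ^+ j * y / (j.+1%:R * j`!%:R) <= expR y.
    by apply: le_trans h; rewrite lerDr.
  rewrite ler_pdivrMr ?mulr_gt0 ?ltr0n ?fact_gt0// => h.
  by rewrite mulrAC ler_pdivrMr ?ltr0n ?fact_gt0// -mulrA.
elim: k => [|k ih].
  rewrite (_ : @expNsum R 0 = (fun y => expR (- y) * (y ^+ 0 / 0`!%:R))) //.
  by apply/funext => y; rewrite /expNsum big_ord1.
rewrite (_ : @expNsum R k.+1 =
  (fun z => @expNsum R k z + expR (- z) * (z ^+ k.+1 / k.+1`!%:R))); last first.
  by apply/funext => z; rewrite /expNsum big_ord_recr/= mulrDr.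
by rewrite -(addr0 0); exact: cvgD.
Unshelve. all: end_near. Qed.

(** The fundamental theorem of calculus on a half-line, kept in the extended reals so that a real
    value also proves finiteness. *)
Lemma integral_itvoy_primitive (R : realType) (f F : R -> R) (l : R) :
  (forall x, 0 <= x -> 0 <= f x) -> continuous f ->
  (forall x, derivable F x 1 /\ 'D_1 F x = f x) -> F x @[x --> +oo%R] --> l ->
  (\int[lebesgue_measure]_(x in `]0%R, +oo[) (f x)%:E = (l - F 0)%:E)%E.
Proof.
move=> f0 cf dF Fl.
rewrite integral_itv_obnd_cbnd; last first.
  apply/measurable_EFinP; apply: measurable_funTS.
  exact: continuous_measurable_fun.
rewrite (@ge0_continuous_FTC2y _ f F 0 l)//.
- exact: continuous_subspaceT.
- by move=> x _; exact: (dF x).1.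
- apply: cvg_at_right_filter; apply/differentiable_continuous.
  exact/derivable1_diffP/(dF 0).1.
- by move=> x _; rewrite derive1E (dF x).2.
Qed.

Lemma integral_expRN (R : realType) (d : R) : 0 < d ->
  (\int[lebesgue_measure]_(s in `]0%R, +oo[) (expR (- (s * d)))%:E
   = (d^-1)%:E)%E.
Proof.
move=> d0; have dn0 : d != 0 by rewrite gt_eqF.
rewrite (@integral_itvoy_primitive _ _ (fun s => - d^-1 * expNsum 0 (d * s)) 0).
- by rewrite mulr0 expNsum0 mulr1 sub0r opprK.
- by move=> *; exact: expR_ge0.
- move=> x; apply: continuous_comp; last exact: continuous_expR.
  by apply: cvgN; apply: cvgMl; exact: cvg_id.
- move=> x.
  have h := @is_deriveZ _ _ _ id d x 1 1 (is_derive_id _ _).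
  have [? ->] := is_deriveZ (- d^-1) (is_derive1_comp (is_derive_expNsum 0 _) h).
  split=> //; rewrite /GRing.scale/= expr0 fact0 (mulrC x).
  by field.
- rewrite -(mulr0 (- d^-1)); apply: cvgMr.
  apply: (@cvg_comp _ _ _ _ _ _ (pinfty_nbhs R)); last exact: expNsum_cvg.
  by apply: gt0_cvgMry => //; exact: cvg_id.
Qed.

Lemma eulerGamma_natS (R : realType) (p : nat) :
  eulerGamma (p.+1%:R : R) = p`!%:R.
Proof.
rewrite /eulerGamma /Rintegral.
have pn0 : p`!%:R != 0 :> R by rewrite pnatr_eq0 -lt0n fact_gt0.
rewrite [X in fine X](_ : _ = \int[lebesgue_measure]_(t in `]0%R, +oo[)
    (t ^+ p * expR (- t))%:E)%E; last first.
  apply: eq_integral => t; rewrite inE/= in_itv/= andbT => t0; congr (_ * _)%:E.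
  by rewrite -natr1 addrK powR_mulrn// ltW.
rewrite (@integral_itvoy_primitive _ _ (fun s => - p`!%:R * expNsum p s) 0).
- by rewrite expNsum0 mulr1 sub0r opprK.
- by move=> *; rewrite mulr_ge0 ?expR_ge0 ?exprn_ge0.
- move=> x; apply: cvgM; first exact: exprn_continuous.
  by apply: continuous_comp; [exact: cvgN|exact: continuous_expR].
- move=> x; have [? ->] := is_deriveZ (- p`!%:R) (is_derive_expNsum p x).
  split=> //; rewrite /GRing.scale/=. by field.
- by rewrite -(mulr0 (- p`!%:R)); apply: cvgMr; exact: expNsum_cvg.
Qed.

(** The substitution y = b x^2 turns the integrand into a multiple of y^k e^-y; it is carried out on
    the primitive, by composing [expNsum k] with b x^2. *)
Lemma integral_gauss_moment (R : realType) (b : R) (k : nat) : 0 < b ->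
  (\int[lebesgue_measure]_(x in `]0%R, +oo[)
     (x ^+ (2 * k).+1 * expR (- (b * x ^+ 2)))%:E =
   (k`!%:R / (2 * b ^+ k.+1))%:E)%E.
Proof.
move=> b0; have bn0 : b != 0 by rewrite gt_eqF.
have kn0 : k`!%:R != 0 :> R by rewrite pnatr_eq0 -lt0n fact_gt0.
set C := k`!%:R / (2 * b ^+ k.+1).
rewrite (@integral_itvoy_primitive _ _ (fun x => - C * expNsum k (b * x ^+ 2)) 0).
- by rewrite expr0n mulr0 expNsum0 mulr1 sub0r opprK.
- by move=> *; rewrite mulr_ge0 ?expR_ge0 ?exprn_ge0.
- move=> x; apply: cvgM; first exact: exprn_continuous.
  apply: continuous_comp; last exact: continuous_expR.
  by apply: cvgN; apply: cvgMr; exact: exprn_continuous.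
- move=> x.
  have h := is_deriveZ b (@is_deriveX _ _ id 2 x 1 1 (is_derive_id _ _)).
  have [? ->] := is_deriveZ (- C) (is_derive1_comp (is_derive_expNsum k _) h).
  split=> //; rewrite /GRing.scale/= /C.
  rewrite !exprfctE/=.
  rewrite exprMn -exprM mulr1 expr1 !exprS; field.
  by rewrite kn0 bn0 expf_neq0.
- rewrite -(mulr0 (- C)); apply: cvgMr.
  apply: (@cvg_comp _ _ _ _ _ _ (pinfty_nbhs R)); last exact: expNsum_cvg.
  apply: gt0_cvgMry => //.
  apply: (@ger_cvgy _ _ _ _ id); last exact: cvg_id.
  by near=> x; rewrite /= expr2 ler_peMl//; near: x; exact: nbhs_pinfty_ge.
Unshelve. all: end_near. Qed.

(** * Tonelli on a rectangle, measurability and integrability tools *)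

(** Extending [f] by zero off the rectangle reduces this to Tonelli on the full product. *)
Lemma ge0_fubini_tonelli_in d1 d2 (T1 : measurableType d1)
    (T2 : measurableType d2) (R : realType)
    (m1 : {sigma_finite_measure set T1 -> \bar R})
    (m2 : {sigma_finite_measure set T2 -> \bar R})
    (A : set T1) (B : set T2) (f : T1 * T2 -> \bar R) :
  measurable A -> measurable B -> measurable_fun setT f ->
  (forall z, (0 <= f z)%E) ->
  (\int[m1]_(x in A) \int[m2]_(y in B) f (x, y) =
   \int[m2]_(y in B) \int[m1]_(x in A) f (x, y))%E.
Proof.
move=> mA mB mf f0.
have mg : measurable_fun setT (f \_ (A `*` B)).
  by apply/(measurable_restrictT _ (measurableX mA mB)); exact: measurable_funTS.
have g0 z : (0 <= (f \_ (A `*` B)) z)%E by rewrite patchE; case: ifP.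
rewrite integral_mkcond [RHS]integral_mkcond.
transitivity (\int[m1]_x \int[m2]_y (f \_ (A `*` B)) (x, y))%E.
  apply: eq_integral => x _; rewrite patchE; case: ifPn => xA.
    rewrite integral_mkcond; apply: eq_integral => y _.
    by rewrite !patchE in_setX xA.
  by rewrite integral0_eq// => y _; rewrite patchE in_setX (negbTE xA).
rewrite fubini_tonelli//.
apply: eq_integral => y _; rewrite [RHS]patchE; case: ifPn => yB.
  rewrite [RHS]integral_mkcond; apply: eq_integral => x _.
  by rewrite !patchE in_setX yB andbT.
by rewrite integral0_eq// => x _; rewrite patchE in_setX (negbTE yB) andbF.
Qed.

(** On positive values the inverse is the real power of exponent -1, and power functions are
    measurable. *)
Lemma measurable_funV_gt0 d (T : measurableType d) (R : realType) (D : set T)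
    (f : T -> R) :
  measurable_fun D f -> (forall x, D x -> 0 < f x) ->
  measurable_fun D (fun x => (f x)^-1).
Proof.
move=> mf f0.
apply: (@eq_measurable_fun _ _ _ _ D (fun x => f x `^ (- 1))).
  by move=> x; rewrite inE => Dx; rewrite powR_inv1// ltW// f0.
exact: measurableT_comp (measurable_powR _) mf.
Qed.

Lemma ge0_integrable_fin d (T : measurableType d) (R : realType)
    (mu : {measure set T -> \bar R}) (D : set T) (f : T -> R) (r : R) :
  measurable_fun D f -> (forall x, D x -> 0 <= f x) ->
  (\int[mu]_(x in D) (f x)%:E = r%:E)%E ->
  mu.-integrable D (EFin \o f).
Proof.
move=> mf f0 fr; apply/integrableP; split; first exact/measurable_EFinP.
rewrite (_ : (\int[mu]_(x in D) _)%E = r%:E) ?ltry// -fr.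
by apply: eq_integral => x; rewrite inE => Dx; rewrite /= ger0_norm// f0.
Qed.

(** * Gaussian moments divided by x^2 + C, as integrals over s *)

Section gauss_moment_div.
Context {R : realType}.
Variables (A C : R) (A0 : 0 < A) (C0 : 0 < C).
Let mu := @lebesgue_measure R.
Let D : set R := `]0%R, +oo[%classic.

Let mD : measurable D. Proof. exact: measurable_itv. Qed.

Let DE x : D x -> 0 < x.
Proof. by rewrite /D/= in_itv/= andbT. Qed.

Lemma measurable_expRN_lin (B : R) : measurable_fun D (fun s => expR (- (s * B))).
Proof.
by apply: measurableT_comp => //; apply: measurableT_comp => //; exact: measurable_funM.
Qed.

Lemma measurable_expRN_sqr (B : R) :
  measurable_fun D (fun x => expR (- (B * x ^+ 2))).
Proof.
apply: measurableT_comp => //; apply: measurableT_comp => //.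
by apply: measurable_funM => //; exact: measurable_funX.
Qed.

Lemma measurable_gauss_moment_div (k : nat) :
  measurable_fun D
    (fun x => x ^+ (2 * k).+1 / (x ^+ 2 + C) * expR (- (A * x ^+ 2))).
Proof.
apply: measurable_funM; last exact: measurable_expRN_sqr.
apply: measurable_funM; first exact: measurable_funX.
apply: measurable_funV_gt0 => [|x _]; last by rewrite ltr_wpDl// sqr_ge0.
by apply: measurable_funD => //; exact: measurable_funX.
Qed.

Lemma measurable_laplace_pow (k : nat) :
  measurable_fun D (fun s => expR (- (s * C)) * (k`!%:R / (2 * (A + s) ^+ k.+1))).
Proof.
apply: measurable_funM; first exact: measurable_expRN_lin.
apply: measurable_funM => //; apply: measurable_funV_gt0 => [|x /DE x0].
  apply: measurable_funM => //; apply: measurable_funX.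
  by apply: measurable_funD.
by rewrite mulr_gt0// exprn_gt0// addr_gt0.
Qed.

(* [1 / (x^2 + C)] is the integral of [exp (- s (x^2 + C))] over [s > 0]. *)
Lemma integral_gauss_moment_div (k : nat) :
  (\int[mu]_(x in D)
     (x ^+ (2 * k).+1 / (x ^+ 2 + C) * expR (- (A * x ^+ 2)))%:E =
   \int[mu]_(s in D)
     (expR (- (s * C)) * (k`!%:R / (2 * (A + s) ^+ k.+1)))%:E)%E.
Proof.
(* The absolute value makes [f] nonnegative on the whole plane, as Tonelli requires here; on [D] it
   disappears. *)
pose f (z : R * R) := (`|z.1| ^+ (2 * k).+1 * expR (- (A * z.1 ^+ 2)) *
  expR (- (z.2 * (z.1 ^+ 2 + C)))).
have f0 z : 0 <= f z by rewrite !mulr_ge0 ?expR_ge0 ?exprn_ge0.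
have mf : measurable_fun setT f.
  apply: measurable_funM; first apply: measurable_funM.
  - by apply: measurable_funX; exact: measurableT_comp.
  - apply: measurableT_comp => //; apply: measurableT_comp => //.
    by apply: measurable_funM => //; exact: measurable_funX.
  - apply: measurableT_comp => //; apply: measurableT_comp => //.
    apply: measurable_funM => //; apply: measurable_funD => //.
    exact: measurable_funX.
transitivity (\int[mu]_(x in D) \int[mu]_(s in D) (f (x, s))%:E)%E.
  apply: eq_integral => x; rewrite inE => /DE x0; rewrite /f/=.
  have xC : 0 < x ^+ 2 + C by rewrite ltr_wpDl// sqr_ge0.
  under eq_integral do rewrite EFinM.
  rewrite ge0_integralZl_EFin//.
  - by rewrite integral_expRN// -EFinM gtr0_norm// mulrAC.
  - by apply/measurable_EFinP; exact: measurable_expRN_lin.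
have mEf : measurable_fun setT (EFin \o f) by exact/measurable_EFinP.
have Ef0 z : (0 <= (EFin \o f) z)%E by rewrite lee_fin.
rewrite (ge0_fubini_tonelli_in mu mu mD mD mEf Ef0)/=.
apply: eq_integral => s; rewrite inE => /DE s0.
(* The exponent -A x^2 - s (x^2 + C) regroups as -s C - (A + s) x^2, leaving a Gaussian moment of
   rate A + s in x. *)
transitivity (\int[mu]_(x in D) ((expR (- (s * C)))%:E *
    (x ^+ (2 * k).+1 * expR (- ((A + s) * x ^+ 2)))%:E))%E.
  apply: eq_integral => x; rewrite inE => /DE x0; rewrite /f/= -EFinM; congr EFin.
  rewrite gtr0_norm// [RHS]mulrCA -[LHS]mulrA -!expRD; congr (_ * expR _); ring.
rewrite ge0_integralZl_EFin//.
- by rewrite integral_gauss_moment ?addr_gt0.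
- by move=> x /DE x0; rewrite lee_fin mulr_ge0 ?expR_ge0 ?exprn_ge0 ?ltW.
- apply/measurable_EFinP; apply: measurable_funM; first exact: measurable_funX.
  exact: measurable_expRN_sqr.
Qed.

(** Since 1/(x^2 + C) is at most 1/C, a multiple of the pure Gaussian moment dominates. *)
Lemma integrable_gauss_moment_div (k : nat) :
  mu.-integrable D (EFin \o
    (fun x => x ^+ (2 * k).+1 / (x ^+ 2 + C) * expR (- (A * x ^+ 2)))).
Proof.
have iG : mu.-integrable D
    (EFin \o (fun x => x ^+ (2 * k).+1 * expR (- (A * x ^+ 2)))).
  apply: ge0_integrable_fin (integral_gauss_moment _ A0).
    by apply: measurable_funM; [exact: measurable_funX|exact: measurable_expRN_sqr].
  by move=> x /DE x0; rewrite mulr_ge0 ?expR_ge0 ?exprn_ge0 ?ltW.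
have iG2 := integrableZl (mu := mu) mD C^-1 iG.
apply: (le_integrable (mu := mu) mD _ _ iG2).
  apply/measurable_EFinP; exact: measurable_gauss_moment_div.
move=> x /DE x0; rewrite /= lee_fin.
have xC : 0 < x ^+ 2 + C by rewrite ltr_wpDl// sqr_ge0.
have [xC' C' x'] : [/\ 0 <= x ^+ 2 + C, 0 <= C & 0 <= x] by rewrite !ltW.
rewrite !ger0_norm ?mulr_ge0 ?invr_ge0 ?expR_ge0 ?exprn_ge0//.
rewrite mulrAC [leRHS]mulrC ler_pM2l ?mulr_gt0 ?exprn_gt0 ?expR_gt0//.
by rewrite lef_pV2 ?posrE// lerDr sqr_ge0.
Qed.

(** No estimate in s is made: the integrand is nonnegative and its integral equals one already known
    to be finite. *)
Lemma integrable_laplace_pow (k : nat) :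
  mu.-integrable D (EFin \o
    (fun s => expR (- (s * C)) * (k`!%:R / (2 * (A + s) ^+ k.+1)))).
Proof.
apply: (@ge0_integrable_fin _ _ _ _ _ _ (fine (\int[mu]_(x in D)
     (x ^+ (2 * k).+1 / (x ^+ 2 + C) * expR (- (A * x ^+ 2)))%:E)%E)).
- exact: measurable_laplace_pow.
- move=> s /DE s0; rewrite mulr_ge0 ?expR_ge0 ?divr_ge0 ?mulr_ge0 ?exprn_ge0//.
  by rewrite addr_ge0 ?ltW.
- rewrite fineK; first by rewrite integral_gauss_moment_div.
  exact: (integrable_fin_num (mu := mu) mD (integrable_gauss_moment_div k)).
Qed.

End gauss_moment_div.

(** * Growth and convergence of the power series of J_0 *)

Lemma norm_besselJ0_term (R : realType) (x : R) (k : nat) :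
  `|(-1) ^+ k * (x / 2) ^+ (2 * k) / k`!%:R ^+ 2| =
  ((x / 2) ^+ 2) ^+ k / k`!%:R ^+ 2.
Proof.
rewrite exprM -mulrA normrM normrX normrN normr1 expr1n mul1r ger0_norm//.
exact: divr_ge0 (exprn_ge0 _ (sqr_ge0 _)) (sqr_ge0 _).
Qed.

(* Splitting [y = e^-1 * (e y)] trades the size of the constant against an
   arbitrarily slow Gaussian growth. *)
Lemma besselJ0_normed_series_le (R : realType) (e x : R) (n : nat) : 0 < e ->
  \sum_(0 <= k < n) `|(-1) ^+ k * (x / 2) ^+ (2 * k) / k`!%:R ^+ 2| <=
  expR e^-1 * expR (e * (x / 2) ^+ 2).
Proof.
move=> e0; set y := (x / 2) ^+ 2; have y0 : 0 <= y by exact: sqr_ge0.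
have ey0 : 0 <= e * y by rewrite mulr_ge0// ltW.
have ei0 : 0 <= e^-1 by rewrite invr_ge0 ltW.
apply: (@le_trans _ _
  (\sum_(0 <= k < n) expR e^-1 * ((e * y) ^+ k / k`!%:R))); last first.
  by rewrite -mulr_sumr ler_wpM2l ?expR_ge0// series_exp_coeff_le.
apply: ler_sum => k _; rewrite norm_besselJ0_term -/y.
have kn0 : k`!%:R != 0 :> R by rewrite pnatr_eq0 -lt0n fact_gt0.
have en0 : e != 0 by rewrite gt_eqF.
rewrite (_ : y ^+ k / k`!%:R ^+ 2 =
    (e^-1 ^+ k / k`!%:R) * ((e * y) ^+ k / k`!%:R)); last first.
  by rewrite (exprMn _ e) exprVn; field; rewrite kn0 expf_neq0.
rewrite ler_wpM2r ?divr_ge0 ?exprn_ge0//.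
(* A single term of the exponential series at 1/e is at most its partial sum, hence at most
   exp(1/e). *)
apply: le_trans (series_exp_coeff_le k.+1 ei0).
by rewrite big_nat_recr//= lerDr sumr_ge0// => i _; rewrite divr_ge0 ?exprn_ge0.
Qed.

(** [besselJ0] is a [limn], so it is the sum of its series only once convergence is known; the
    preceding bound at e = 1 gives absolute convergence. *)
Lemma besselJ0_cvg (R : realType) (x : R) :
  series (fun k : nat => (-1) ^+ k * (x / 2) ^+ (2 * k) / k`!%:R ^+ 2) @ \oo
    --> besselJ0 x.
Proof.
apply: (@normed_cvg _ R^o).
apply: nondecreasing_is_cvgn.
  by apply: nondecreasing_series => k _ _; exact: normr_ge0.
exists (expR 1^-1 * expR (1 * (x / 2) ^+ 2)) => _ [n _ <-].
exact: besselJ0_normed_series_le.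
Qed.

(** * The Bessel integral as an integral over s *)

Section bessel_gauss.
Context {R : realType}.
Variables (A C q : R) (A0 : 0 < A) (C0 : 0 < C) (q0 : 0 < q).
Let mu := @lebesgue_measure R.
Let D : set R := `]0%R, +oo[%classic.

Let mD : measurable D. Proof. exact: measurable_itv. Qed.

Let DE x : D x -> 0 < x.
Proof. by rewrite /D/= in_itv/= andbT. Qed.

(** Here A and C stand for a^2 and c^2. With [co k] the coefficient of x^(2k) in J_0(q x), [f] is
    the sum of the [co k * m k] and [g] the sum of the [co k * l k]. *)
Let f (x : R) := x / (x ^+ 2 + C) * expR (- (A * x ^+ 2)) * besselJ0 (q * x).

Let m k (x : R) := x ^+ (2 * k).+1 / (x ^+ 2 + C) * expR (- (A * x ^+ 2)).

Let co k : R := (-1) ^+ k * (q / 2) ^+ (2 * k) / k`!%:R ^+ 2.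

Let l k (s : R) := expR (- (s * C)) * (k`!%:R / (2 * (A + s) ^+ k.+1)).

Let g (s : R) := expR (- (s * C)) * expR (- (q ^+ 2 / (4 * (A + s)))) / (2 * (A + s)).

Let fE k x : co k * m k x = x / (x ^+ 2 + C) * expR (- (A * x ^+ 2)) *
  ((-1) ^+ k * (q * x / 2) ^+ (2 * k) / k`!%:R ^+ 2).
Proof.
rewrite /co /m (mulrAC q x) (exprMn _ (q / 2)) (exprS x (2 * k)).
by ring.
Qed.

Lemma bessel_gauss_series : mu.-integrable D (EFin \o f) /\
  series (fun k => \int[mu]_(x in D) (co k * m k x)) @ \oo -->
  \int[mu]_(x in D) f x.
Proof.
(* With this [e] the bound on J_0(q x) grows like exp(A x^2/2), so half of the Gaussian decay
   survives in the dominating function. *)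
pose e := 2 * A / q ^+ 2; have e0 : 0 < e by rewrite !(divr_gt0, mulr_gt0, exprn_gt0).
have eq2 x : e * (q * x / 2) ^+ 2 = A / 2 * x ^+ 2.
  by rewrite /e; field; rewrite gt_eqF.
have A20 : 0 < A / 2 by rewrite divr_gt0.
apply: (@Rintegral_series _ _ _ mu D _ _ (fun x => expR e^-1 *
    (x ^+ (2 * 0).+1 / (x ^+ 2 + C) * expR (- (A / 2 * x ^+ 2))))) => //.
- move=> k; apply: measurable_funM => //; exact: measurable_gauss_moment_div.
- by have := integrableZl (mu := mu) mD (expR e^-1) (integrable_gauss_moment_div A20 C0 0).
- move=> x n /DE x0; under eq_bigr do rewrite fE normrM.
  have xC : 0 <= x ^+ 2 + C by rewrite addr_ge0 ?sqr_ge0// ltW.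
  have h0 : 0 <= x / (x ^+ 2 + C) * expR (- (A * x ^+ 2)).
    by rewrite mulr_ge0 ?expR_ge0// divr_ge0// ltW.
  rewrite -mulr_sumr ger0_norm//.
  apply: le_trans (ler_wpM2l h0 (besselJ0_normed_series_le _ _ e0)) _.
  rewrite eq2 muln0 expr1 le_eqVlt; apply/predU1P; left.
  rewrite [RHS]mulrCA -[LHS]mulrA; congr (_ * _).
  by rewrite mulrCA -!expRD; congr (expR (_ + _)); field.
- move=> x /DE x0.
  rewrite (_ : series _ = (fun n => x / (x ^+ 2 + C) * expR (- (A * x ^+ 2)) *
    series (fun k => (-1) ^+ k * (q * x / 2) ^+ (2 * k) / k`!%:R ^+ 2) n)).
    by apply: cvgMr; exact: besselJ0_cvg.
  apply/funext => n; rewrite !seriesEnat/= mulr_sumr.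
  by apply: eq_bigr => k _; rewrite fE.
Qed.

(** The k! in [l k] cancels one of the two factorials in [co k], which leaves the exponential series
    at -q^2/(4(A + s)). *)
Lemma laplace_exp_series : mu.-integrable D (EFin \o g) /\
  series (fun k => \int[mu]_(s in D) (co k * l k s)) @ \oo -->
  \int[mu]_(s in D) g s.
Proof.
have lE k s : D s -> co k * l k s = expR (- (s * C)) / (2 * (A + s)) *
    exp_coeff (- (q ^+ 2 / (4 * (A + s)))) k.
  move=> /DE s0; have As : A + s != 0 by rewrite gt_eqF// addr_gt0.
  have kn0 : k`!%:R != 0 :> R by rewrite pnatr_eq0 -lt0n fact_gt0.
  rewrite /co /l /exp_coeff/= exprM.
  rewrite (_ : - (q ^+ 2 / (4 * (A + s))) = -1 * ((q / 2) ^+ 2) * (A + s)^-1); last by field.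
  move: ((q / 2) ^+ 2) => Q.
  rewrite (exprMn _ (-1 * Q)) (exprMn _ (-1)) exprVn (exprS _ k).
  by field; rewrite kn0 As expf_neq0.
(* Taking norms flips the sign of the exponent; exp(q^2/(4(A + s)))/(2(A + s)) is then bounded by
   its value at s = 0. *)
apply: (@Rintegral_series _ _ _ mu D _ _
  (fun s => expR (q ^+ 2 / (4 * A)) / (2 * A) * expR (- (s * C)))) => //.
- move=> k; apply: measurable_funM => //; exact: measurable_laplace_pow.
- have iE : mu.-integrable D (EFin \o (fun s => expR (- (s * C)))).
    apply: ge0_integrable_fin (integral_expRN C0); first exact: measurable_expRN_lin.
    by move=> s _; exact: expR_ge0.
  exact: (integrableZl (mu := mu) mD (expR (q ^+ 2 / (4 * A)) / (2 * A)) iE).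
- move=> s n Ds; have s0 := DE Ds; have As : 0 < A + s by rewrite addr_gt0.
  have h0 : 0 <= expR (- (s * C)) / (2 * (A + s)).
    by rewrite divr_ge0 ?expR_ge0// mulr_ge0// ltW.
  have z0 : 0 <= q ^+ 2 / (4 * (A + s)) by rewrite divr_ge0 ?sqr_ge0// mulr_ge0// ltW.
  rewrite (eq_bigr (fun k => expR (- (s * C)) / (2 * (A + s)) *
      ((q ^+ 2 / (4 * (A + s))) ^+ k / k`!%:R))); last first.
    move=> k _; rewrite lE// normrM ger0_norm// /exp_coeff/= normrM normrX normrN.
    by rewrite !ger0_norm// invr_ge0.
  rewrite -mulr_sumr -[leLHS]mulrA [leRHS]mulrC ler_wpM2l ?expR_ge0//.
  rewrite [leRHS]mulrC ler_pM ?invr_ge0 ?sumr_ge0//.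
  - by rewrite mulr_ge0// ltW.
  - by move=> k _; rewrite divr_ge0 ?exprn_ge0.
  - by rewrite lef_pV2 ?posrE ?mulr_gt0// ler_wpM2l// lerDl ltW.
  - apply: le_trans (series_exp_coeff_le n z0) _.
    rewrite ler_expR ler_wpM2l ?sqr_ge0// lef_pV2 ?posrE ?mulr_gt0//.
    by rewrite ler_wpM2l// lerDl ltW.
- move=> s Ds.
  rewrite (_ : series _ = (fun n => expR (- (s * C)) / (2 * (A + s)) *
    series (exp_coeff (- (q ^+ 2 / (4 * (A + s))))) n)).
    rewrite [g s]mulrAC; apply: cvgMr.
    by rewrite /expR; exact: is_cvg_series_exp_coeff.
  apply/funext => n; rewrite !seriesEnat/= mulr_sumr.
  by apply: eq_bigr => k _; rewrite lE.
Qed.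

(** Both sides are limits of series whose k-th terms agree by [integral_gauss_moment_div]. *)
Lemma integral_bessel_gauss : \int[mu]_(x in D) f x = \int[mu]_(s in D) g s.
Proof.
have [_ fl] := bessel_gauss_series; have [_ gl] := laplace_exp_series.
rewrite -(cvg_lim _ fl)// -(cvg_lim _ gl)//; congr (limn (series _)).
apply/funext => k; rewrite !RintegralZl//.
- by rewrite /Rintegral (integral_gauss_moment_div A0 C0).
- exact: integrable_laplace_pow.
- exact: integrable_gauss_moment_div.
Qed.

End bessel_gauss.

(** * Logarithmic change of variables and tails of an even function *)

Lemma cvg_lny (R : realType) : @ln R x @[x --> +oo%R] --> +oo%R.
Proof.
apply/cvgryPge => M; near=> x.
have x0 : 0 < x by [].
by rewrite -[M]expRK ler_ln ?posrE ?expR_gt0//; near: x; exact: nbhs_pinfty_ge.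
Unshelve. all: end_near. Qed.

(** The substitution x = ln(alpha (s + B)), with dx = ds/(s + B). It serves both tails: alpha = 2c/q
    and B = A for the s-integral, alpha = 1/r and B = 1 for the Tricomi series. *)
Lemma ge0_integral_ln_substitution (R : realType) (h : R -> R) (alpha B : R) :
  0 < alpha -> 0 < B -> continuous h -> (forall x, 0 <= h x) ->
  (\int[lebesgue_measure]_(x in `[ln (alpha * B), +oo[) (h x)%:E =
   \int[lebesgue_measure]_(s in `]0%R, +oo[)
     (h (ln (alpha * (s + B))) / (s + B))%:E)%E.
Proof.
move=> al0 B0 ch h0; pose F s := ln (alpha * (s + B)).
(* Working on s > -B puts 0 in the interior, so the one-sided limits at 0 follow from continuity. *)
have dF s : - B < s -> is_derive s 1 F (s + B)^-1.
  move=> Bs; have sB : 0 < s + B by rewrite -ltrBlDr sub0r.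
  have d1 : is_derive s 1 (fun s => alpha * (s + B)) alpha.
    have := is_deriveZ alpha (is_deriveD (is_derive_id s 1) (is_derive_cst B s 1)).
    by rewrite addr0 /GRing.scale/= mulr1.
  have := @is_derive1_comp _ _ _ s _ _ (is_derive1_ln (mulr_gt0 al0 sB)) d1.
  by rewrite invfM mulrAC mulVf ?gt_eqF// mul1r.
have F'E s : - B < s -> F^`()%classic s = (s + B)^-1.
  by move=> Bs; rewrite derive1E; have [_ ->] := dF s Bs.
have cV s : - B < s -> {for s, continuous (fun s => (s + B)^-1)}.
  move=> Bs; have sB : 0 < s + B by rewrite -ltrBlDr sub0r.
  by apply: cvgV; [rewrite gt_eqF|apply: cvgD; [exact: cvg_id|exact: cvg_cst]].
have cF s : - B < s -> {for s, continuous F}.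
  move=> Bs; apply/differentiable_continuous/derivable1_diffP.
  by have [] := dF s Bs.
have B0' : - B < 0 by rewrite oppr_lt0.
have F0 : F 0 = ln (alpha * B) by rewrite /F add0r.
have addy : (s + B) @[s --> +oo%R] --> +oo%R.
  apply: (@ger_cvgy _ _ _ _ id); last exact: cvg_id.
  by near=> s; rewrite /= lerDl ltW.
have geB s : 0 <= s -> - B < s by exact: lt_le_trans.
have cF' s : - B < s -> {for s, continuous F^`()%classic}.
  move=> Bs; rewrite /prop_for /continuous_at F'E//.
  apply: cvg_trans (cV s Bs); apply: near_eq_cvg; near=> z.
  by rewrite F'E//; near: z; exact: lt_nbhsr.
have incF : {in `[0, +oo[ &, {homo F : x y / x < y}}.
  move=> x y; rewrite !in_itv/= !andbT => x0 y0 xy.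
  by rewrite ltr_ln ?posrE ?mulr_gt0 ?ltr_wpDl// ltr_pM2l// ltrD2r.
have cF'0 : {in `]0, +oo[, continuous F^`()%classic}.
  by move=> s; rewrite in_itv/= andbT => /ltW/geB/cF'.
have F'0 : cvg (F^`()%classic x @[x --> 0^'+]).
  apply/cvg_ex; exists (F^`()%classic 0); apply: cvg_at_right_filter; exact: cF'.
have F'y : cvg (F^`()%classic x @[x --> +oo%R]).
  apply/cvg_ex; exists 0.
  have : (fun s => (s + B)^-1) s @[s --> +oo%R] --> 0.
    apply/gtr0_cvgV0.
      by near=> s; rewrite addr_gt0.
    exact: addy.
  apply: cvg_trans; apply: near_eq_cvg; near=> s.
  by rewrite F'E// geB.
have derF : derivable_oy_Rcontinuous F 0.
  split; last by apply: cvg_at_right_filter; exact: cF.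
  by move=> s; rewrite in_itv/= andbT => /ltW/geB/dF[].
have Fy : F x @[x --> +oo%R] --> +oo%R.
  apply: (@cvg_comp _ _ _ (fun s => alpha * (s + B)) (@ln R) _ (pinfty_nbhs R));
    last exact: cvg_lny.
  by apply: gt0_cvgMry => //; exact: addy.
rewrite -F0 (increasing_ge0_integration_by_substitutiony incF cF'0 F'0 F'y derF Fy).
- rewrite [RHS]integral_itv_obnd_cbnd.
    apply: eq_integral => s; rewrite inE/= in_itv/= andbT => s0.
    by rewrite mulrfctE/= F'E// geB.
  apply/measurable_EFinP; apply: measurable_funM.
    apply: measurableT_comp; first exact: continuous_measurable_fun.
    apply: measurableT_comp; first exact: measurable_ln.
    by apply: measurable_funM => //; exact: measurable_funD.
  apply: measurable_funV_gt0; first exact: measurable_funD.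
  by move=> s; rewrite /= in_itv/= andbT => s0; rewrite addr_gt0.
- exact: continuous_subspaceT.
- by [].
Unshelve. all: end_near. Qed.

(** Reflection carries the second tail to the half-line below t; with the first tail it covers the
    line, overlapping only in the null set {t}. By evenness the whole line counts twice the positive
    half. *)
Lemma ge0_integral_even_tails (R : realType) (h : R -> R) (t : R) :
  continuous h -> (forall x, 0 <= h x) -> (forall x, h (- x) = h x) ->
  (\int[lebesgue_measure]_(x in `[t, +oo[) (h x)%:E +
   \int[lebesgue_measure]_(x in `[(- t)%R, +oo[) (h x)%:E =
   2%:E * \int[lebesgue_measure]_(x in `]0%R, +oo[) (h x)%:E)%E.
Proof.
move=> ch h0 hN.
have mh : measurable_fun setT h by exact: continuous_measurable_fun.
have mEh D : measurable_fun D (EFin \o h).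
  by apply/measurable_EFinP; exact: measurable_funTS.
rewrite integral_itv_obnd_cbnd; last exact: mEh.
transitivity (\int[lebesgue_measure]_x (h x)%:E)%E; last first.
  rewrite ge0_symfun_integralT//; last by move=> x /=; rewrite hN.
  by congr (_ * _)%E; rewrite -set_itvcy.
rewrite -(setUv `[t, +oo[%classic) ge0_integral_setU//=; last 4 first.
- exact: measurableC.
- by rewrite setUv; exact: mEh.
- by move=> x _; rewrite lee_fin.
- exact/disj_setPCl.
congr (_ + _)%E; rewrite setCitvr integral_itv_bndo_bndc; last exact: mEh.
rewrite -[X in `]-oo, X]]opprK ge0_integration_by_substitutionNy//.
- by apply: eq_integral => x _ /=; rewrite hN.
- exact: continuous_subspaceT.
Qed.

(** * The Tricomi series summed under the integral sign *)

Lemma tricomi_natS (R : realType) (p : nat) (x : R) :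
  tricomi p.+1%:R 1 x = p`!%:R^-1 *
    \int[lebesgue_measure]_(t in `]0%R, +oo[)
      (expR (- (x * t)) * t ^+ p / (1 + t) ^+ p.+1).
Proof.
rewrite /tricomi eulerGamma_natS; congr (_ * _).
apply: eq_Rintegral => t; rewrite inE/= in_itv/= andbT => t0.
rewrite (_ : 1 - p.+1%:R - 1 = - p.+1%:R :> R); last by ring.
rewrite powRN -natr1 addrK natr1 !powR_mulrn ?ltW//.
by rewrite addr_gt0.
Qed.

(** The 1/p! from the Gamma factor turns the sum into the exponential series at y t/(1 + t). This
    argument is at most y, so e^y e^(-x t) dominates. *)
Lemma tricomi_series (R : realType) (x y : R) : 0 < x -> 0 <= y ->
  let w t := expR (- (x * t)) * expR (y * (t / (1 + t))) / (1 + t) in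
  lebesgue_measure.-integrable `]0%R, +oo[ (EFin \o w) /\
  series (fun p => y ^+ p * tricomi p.+1%:R 1 x) @ \oo -->
  \int[lebesgue_measure]_(t in `]0%R, +oo[) w t.
Proof.
move=> x0 y0 w; set D : set R := `]0%R, +oo[%classic.
have mD : measurable D by exact: measurable_itv.
have DE t : D t -> 0 < t by rewrite /D/= in_itv/= andbT.
pose b p (t : R) := expR (- (x * t)) * t ^+ p / (1 + t) ^+ p.+1.
have mx : measurable_fun D (fun t => expR (- (x * t))).
  by under eq_fun do rewrite mulrC; exact: measurable_expRN_lin.
have iE : lebesgue_measure.-integrable D (EFin \o (fun t => expR (- (x * t)))).
  apply: (@ge0_integrable_fin _ _ _ lebesgue_measure D _ x^-1) => //.
  rewrite -integral_expRN//; apply: eq_integral => t _.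
  by rewrite mulrC.
have mb p : measurable_fun D (b p).
  rewrite /b; apply: measurable_funM; first apply: measurable_funM => //.
  apply: measurable_funV_gt0 => [|t /DE t0]; last first.
    by rewrite exprn_gt0// addr_gt0.
  by apply: measurable_funX; exact: measurable_funD.
have bE p t : D t -> y ^+ p / p`!%:R * b p t =
    expR (- (x * t)) / (1 + t) * ((y * (t / (1 + t))) ^+ p / p`!%:R).
  move=> /DE t0; have t1 : 1 + t != 0 by rewrite gt_eqF// addr_gt0.
  have pn0 : p`!%:R != 0 :> R by rewrite pnatr_eq0 -lt0n fact_gt0.
  rewrite /b (exprMn _ y) (exprMn _ t) exprVn (exprS _ p).
  by field; rewrite pn0 t1 expf_neq0.
have b0 p t : D t -> 0 <= b p t.
  move=> /DE /ltW t0; rewrite /b divr_ge0 ?mulr_ge0 ?expR_ge0 ?exprn_ge0//.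
  by rewrite addr_ge0.
have b1 p t : D t -> b p t <= expR (- (x * t)).
  move=> /DE t0; rewrite /b -mulrA ler_piMr ?expR_ge0//.
  rewrite ler_pdivrMr ?exprn_gt0 ?addr_gt0// mul1r.
  rewrite (@le_trans _ _ ((1 + t) ^+ p))// ?lerXn2r ?nnegrE ?addr_ge0 ?(ltW t0) ?lerDr//.
  by rewrite ler_weXn2l// lerDl ltW.
have ib p : lebesgue_measure.-integrable D (EFin \o b p).
  apply: (le_integrable (mu := lebesgue_measure) mD _ _ iE).
    by apply/measurable_EFinP; exact: mb.
  move=> t Dt; rewrite /= lee_fin ger0_norm ?b0// ger0_norm ?expR_ge0//.
  exact: b1.
rewrite (_ : (fun p => _) = (fun p =>
  \int[lebesgue_measure]_(t in D) (y ^+ p / p`!%:R * b p t))); last first.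
  by apply/funext => p; rewrite tricomi_natS mulrA RintegralZl.
apply: (@Rintegral_series _ _ _ lebesgue_measure D _ _
  (fun t => expR y * expR (- (x * t)))) => //.
- by move=> p; apply: measurable_funM => //; exact: mb.
- exact: (integrableZl (mu := lebesgue_measure) mD (expR y) iE).
- move=> t n Dt; have t0 := DE _ Dt.
  have t1 : 0 < 1 + t by rewrite addr_gt0.
  have z0 : 0 <= y * (t / (1 + t)) by rewrite mulr_ge0// divr_ge0 ?ltW.
  rewrite (eq_bigr (fun p => expR (- (x * t)) / (1 + t) *
      ((y * (t / (1 + t))) ^+ p / p`!%:R))); last first.
    move=> p _; rewrite bE// ger0_norm// mulr_ge0 ?divr_ge0 ?exprn_ge0 ?expR_ge0//.
    exact: ltW.
  rewrite -mulr_sumr mulrC ler_pM ?divr_ge0 ?expR_ge0 ?(ltW t1)//.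
  + by rewrite sumr_ge0// => p _; rewrite divr_ge0 ?exprn_ge0.
  + apply: le_trans (series_exp_coeff_le n z0) _.
    rewrite ler_expR ler_piMr// ler_pdivrMr// mul1r lerDr//.
  + by rewrite ler_piMr ?expR_ge0// invf_le1// lerDl ltW.
- move=> t Dt; rewrite (_ : series _ = (fun n => expR (- (x * t)) / (1 + t) *
    series (exp_coeff (y * (t / (1 + t)))) n)).
    rewrite [w t]mulrAC; apply: cvgMr.
    by rewrite /expR; exact: is_cvg_series_exp_coeff.
  apply/funext => n; rewrite !seriesEnat/= mulr_sumr.
  by apply: eq_bigr => p _; rewrite bE.
Qed.

(** * The two tails assembled into K_0 *)

(** [w] is the summed integrand of [tricomi_series] at x = q^2/(4A) and y = A c^2. Integrability of
    [g] and [w] makes the two tails, computed in the extended reals, finite. *)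
Lemma integral_laplace_besselK0 (R : realType) (A c q : R) :
  0 < A -> 0 < c -> 0 < q ->
  let mu := @lebesgue_measure R in
  let g s := expR (- (s * c ^+ 2)) * expR (- (q ^+ 2 / (4 * (A + s)))) /
    (2 * (A + s)) in
  let w t := expR (- (q ^+ 2 / (4 * A) * t)) *
    expR (A * c ^+ 2 * (t / (1 + t))) / (1 + t) in
  mu.-integrable `]0%R, +oo[ (EFin \o g) ->
  mu.-integrable `]0%R, +oo[ (EFin \o w) ->
  \int[mu]_(s in `]0%R, +oo[) g s = expR (A * c ^+ 2) * besselK0 (q * c) -
    2^-1 * expR (- (q ^+ 2 / (4 * A))) * \int[mu]_(t in `]0%R, +oo[) w t.
Proof.
move=> A0 c0 q0 mu g w ig iw.
have mD : measurable (`]0%R, +oo[%classic : set R) by exact: measurable_itv.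
have An0 : A != 0 by rewrite gt_eqF.
have cn0 : c != 0 by rewrite gt_eqF.
have qn0 : q != 0 by rewrite gt_eqF.
pose h (t : R) := expR (- (q * c * ((expR t + expR (- t)) / 2))).
have h0 t : 0 <= h t by exact: expR_ge0.
have ch : continuous h.
  move=> t; apply: continuous_comp; last exact: continuous_expR.
  apply: cvgN; apply: cvgMr; apply: cvgMl; apply: cvgD.
    exact: continuous_expR.
  by apply: continuous_comp; [exact: cvgN|exact: continuous_expR].
have hN t : h (- t) = h t by rewrite /h opprK addrC.
(* ln r is the image of s = 0 under e^t = (2c/q)(s + A). *)
pose r := 2 * c * A / q; have r0 : 0 < r by rewrite divr_gt0 ?mulr_gt0.
have hln z : 0 < z -> h (ln z) = expR (- (q * c * ((z + z^-1) / 2))).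
  by move=> z0; rewrite /h (expRN (ln z)) lnK.
have h1 : (\int[mu]_(x in `[ln r, +oo[) (h x)%:E =
    (2 * expR (- (A * c ^+ 2)) * \int[mu]_(s in `]0%R, +oo[) g s)%:E)%E.
  have al0 : 0 < 2 * c / q by rewrite divr_gt0 ?mulr_gt0.
  rewrite (_ : r = 2 * c / q * A); last by rewrite /r; field.
  rewrite ge0_integral_ln_substitution//.
  rewrite -RintegralZl// /Rintegral fineK; last first.
    exact: (integrable_fin_num (mu := mu) mD (integrableZl (mu := mu) mD _ ig)).
  apply: eq_integral => s; rewrite inE/= in_itv/= andbT => s0; congr EFin.
  have sA : 0 < s + A by rewrite addr_gt0.
  have sAn0 : s + A != 0 by rewrite gt_eqF.
  have -> : g s = expR (- (s * c ^+ 2) - q ^+ 2 / (4 * (s + A))) / (2 * (s + A)).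
    by rewrite /g expRD (addrC A).
  transitivity (expR (- (A * c ^+ 2)) *
    expR (- (s * c ^+ 2) - q ^+ 2 / (4 * (s + A))) / (s + A)); last by field.
  (* For z = (2c/q)(s + A), q c (z + 1/z)/2 equals c^2 (s + A) + q^2/(4(s + A)). *)
  rewrite hln ?(mulr_gt0 al0 sA)// -expRD; congr (expR _ / _).
  by field; rewrite qn0 cn0 sAn0.
have h2 : (\int[mu]_(x in `[(- ln r)%R, +oo[) (h x)%:E =
    (expR (- (q ^+ 2 / (4 * A))) * expR (- (A * c ^+ 2)) *
     \int[mu]_(t in `]0%R, +oo[) w t)%:E)%E.
  have al0 : 0 < r^-1 by rewrite invr_gt0.
  rewrite -lnV ?posrE// -[r^-1]mulr1.
  rewrite ge0_integral_ln_substitution//.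
  rewrite -RintegralZl// /Rintegral fineK; last first.
    exact: (integrable_fin_num (mu := mu) mD (integrableZl (mu := mu) mD _ iw)).
  apply: eq_integral => t; rewrite inE/= in_itv/= andbT => t0; congr EFin.
  have t1 : 0 < t + 1 by rewrite addr_gt0.
  have tn0 : t + 1 != 0 by rewrite gt_eqF.
  (* For z = (1 + t)/r, q c (z + 1/z)/2 equals q^2 (1 + t)/(4A) + A c^2/(1 + t), and 1/(1 + t) = 1 -
     t/(1 + t). *)
  rewrite hln ?(mulr_gt0 al0 t1)// /w (addrC 1 t).
  rewrite mulrA [in RHS]mulrA -!expRD; congr (expR _ / _).
  by rewrite /r; field; rewrite qn0 cn0 An0 tn0.
have := ge0_integral_even_tails (ln r) ch h0 hN.
rewrite -/mu h1 h2 -EFinD.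
rewrite /besselK0 /Rintegral -/mu -/(h _).
(* The left side is finite, so the infinite values of the integral behind K_0 are contradictory. *)
case: (\int[mu]_(x in `]0%R, +oo[) (h x)%:E)%E => [K| |].
- move=> /= [E].
  have en0 : expR (A * c ^+ 2) != 0 by rewrite gt_eqF// expR_gt0.
  move: E; rewrite (expRN (A * c ^+ 2)) => E.
  have -> : K = (2 * K) / 2 by field.
  by rewrite -E; field.
- by rewrite mulry/= gtr0_sg// mul1e.
- by rewrite mulrNy/= gtr0_sg// mul1e.
Qed.

(** * Both series forms of the identity *)

(** Integrability and convergence are asserted beside the equalities because the real integral and
    [limn] also take default values. *)
Theorem mainTheorem3 (R : realType) (a c q : R)
    (ha : 0 < a) (hc : 0 < c) (hq : 0 < q) :
  let f := fun x : R =>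
    x / (x ^+ 2 + c ^+ 2) * expR (- (a ^+ 2 * x ^+ 2)) * besselJ0 (q * x) in
  let F := fun p : nat =>
    (2 * a ^+ 2 * c / q) ^+ (2 * p) *
    hyp2F0 p.+1%:R p.+1%:R (- (4 * a ^+ 2 / q ^+ 2)) in
  let P := fun p : nat =>
    (a * c) ^+ (2 * p) * tricomi p.+1%:R 1 (q ^+ 2 / (4 * a ^+ 2)) in
  [/\ lebesgue_measure.-integrable `]0%R, +oo[ (EFin \o f),
      cvgn (series F) /\
      \int[lebesgue_measure]_(x in `]0%R, +oo[) f x =
        expR ((a * c) ^+ 2) * besselK0 (q * c)
        - 2 * a ^+ 2 / q ^+ 2 * expR (- (q ^+ 2 / (4 * a ^+ 2)))
          * limn (series F)
    & cvgn (series P) /\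
      \int[lebesgue_measure]_(x in `]0%R, +oo[) f x =
        expR ((a * c) ^+ 2) * besselK0 (q * c)
        - 2^-1 * expR (- (q ^+ 2 / (4 * a ^+ 2)))
          * limn (series P)].
Proof.
move=> f F P.
have a2 : 0 < a ^+ 2 by rewrite exprn_gt0.
have c2 : 0 < c ^+ 2 by rewrite exprn_gt0.
set x := q ^+ 2 / (4 * a ^+ 2).
have x0 : 0 < x by rewrite divr_gt0 ?exprn_gt0 ?mulr_gt0.
have [iw Pw] := tricomi_series x0 (ltW (mulr_gt0 a2 c2)).
have PE : P = fun p => (a ^+ 2 * c ^+ 2) ^+ p * tricomi p.+1%:R 1 x.
  by apply/funext => p; rewrite /P exprM (exprMn _ a c).
(* By [hyp2F0_tricomi] the 2F0 factor is x^(p+1) times the Tricomi function, and (2a^2c/q)^2 x =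
   (ac)^2. The spare factor x turns the prefactor 2a^2/q^2 into 1/2. *)
have FE : F = fun p => x * P p.
  apply/funext => p; rewrite /F /P -/x.
  rewrite (_ : 4 * a ^+ 2 / q ^+ 2 = x^-1); last by rewrite /x invf_div.
  rewrite hyp2F0_tricomi// [LHS]mulrA [RHS]mulrA; congr (_ * _).
  rewrite (exprS x p) mulrCA; congr (_ * _); rewrite !(exprM _ 2) -[LHS]exprMn.
  by congr (_ ^+ _); rewrite /x; field; rewrite !gt_eqF.
have Fw : series F @ \oo --> x * limn (series P).
  rewrite FE (_ : series _ = fun n => x * series P n).
    by apply: cvgMr; rewrite PE; apply/cvg_ex; eexists; exact: Pw.
  by apply/funext => n; rewrite !seriesEnat/= mulr_sumr.
have [If _] := bessel_gauss_series a2 c2 hq.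
have [ig _] := laplace_exp_series q a2 c2.
have Pc : cvgn (series P) by rewrite PE; apply/cvg_ex; eexists; exact: Pw.
have Pl : limn (series P) = \int[lebesgue_measure]_(t in `]0%R, +oo[)
  (expR (- (x * t)) * expR (a ^+ 2 * c ^+ 2 * (t / (1 + t))) / (1 + t)).
  by rewrite PE; apply/cvg_lim => //; exact: Pw.
have I : \int[lebesgue_measure]_(x in `]0%R, +oo[) f x =
    expR ((a * c) ^+ 2) * besselK0 (q * c) - 2^-1 * expR (- x) * limn (series P).
  rewrite Pl exprMn -(integral_laplace_besselK0 a2 hc hq ig iw).
  exact: (integral_bessel_gauss a2 c2 hq).
split=> //; split=> //; first by apply/cvg_ex; eexists; exact: Fw.
rewrite I (cvg_lim _ Fw)// /x; congr (_ - _).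
by field; rewrite !gt_eqF.
Qed.
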